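(* Let $(X,\to,{}^*,1)$ be an involutive BE algebra. Then $X$ satisfies both (QW) $x\to ((x\wedge y)\wedge (z\wedge x))=(x\to y)\wedge (x\to z)$ for all $x,y,z\in X$, and (An) for all $x,y\in X$, $x\to y=1$ and $y\to x=1$ imply $x=y$, if and only if $x\vee y=y\vee x$ for all $x,y\in X$. (That is, a quantum-Wajsberg algebra is a Wajsberg algebra if and only if (An), antisymmetry of $\le$, holds.)
   Context: A BE algebra is an algebra $(X,\to,1)$ of type $(2,0)$ such that for all $x,y,z\in X$: $x\to x=1$; $x\to 1=1$; $1\to x=x$; $x\to(y\to z)=y\to(x\to z)$. Write $x\le y$ iff $x\to y=1$ (in general $\le$ is not a partial order). It is bounded if there is $0\in X$ with $0\le x$ for all $x$; then $x^*:=x\to 0$. A bounded BE algebra is involutive if $x^{**}=x$ for all $x$; it is then written $(X,\to,{}^*,1)$, with $0=1^*$. In an involutive BE algebra put $x\vee y:=(x\to y)\to y$ and $x\wedge y:=(x^*\vee y^* )^*=((x^*\to y^* )\to y^* )^*$. A quantum-Wajsberg algebra is an involutive BE algebra satisfying (QW). A Wajsberg algebra is an algebra $(X,\to,{}^*,1)$ of type $(2,1,0)$ such that for all $x,y,z\in X$: $1\to x=x$; $(y\to z)\to((z\to x)\to(y\to x))=1$; $(x\to y)\to y=(y\to x)\to x$; $(x^*\to y^* )\to(y\to x)=1$. *)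

(* Defs.v *)
Set Implicit Arguments.
Unset Strict Implicit.
Unset Printing Implicit Defensive.

(* The laws are those of (X, ->, 1); [ble x y] is in general only a reflexive
   relation, not a partial order. *)
Record is_BE (X : Type) (imp : X -> X -> X) (one : X) : Prop := {
  be_refl : forall x, imp x x = one;
  be_top : forall x, imp x one = one;
  be_unit : forall x, imp one x = x;
  be_exchange : forall x y z, imp x (imp y z) = imp y (imp x z)
}.

Definition ble (X : Type) (imp : X -> X -> X) (one x y : X) : Prop :=
  imp x y = one.

Record is_bounded_BE (X : Type) (imp : X -> X -> X) (one zero : X) : Prop := {
  bounded_BE : is_BE imp one;
  bounded_zero : forall x, ble imp one zero x
}.

Record star_algebra : Type := StarAlgebra {
  carrier :> Type;
  imp : carrier -> carrier -> carrier;
  star : carrier -> carrier;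
  one : carrier
}.

Arguments one {s}.

Declare Scope qw_scope.
Delimit Scope qw_scope with QW.
Notation "x ~> y" := (imp x y) (at level 55, right associativity) : qw_scope.
Notation "x ^*" := (star x) (at level 2, format "x ^*") : qw_scope.
Notation "x ⊑ y" := (ble (@imp _) one x y)
  (at level 70, no associativity) : qw_scope.
Local Open Scope qw_scope.

(* The star of the signature is derived from a least element: x^* = x ~> 0.
   Then 0 = one^*, by [be_unit]. *)
Definition is_involutive_BE (A : star_algebra) : Prop :=
  exists zero : A,
    is_bounded_BE (@imp A) one zero /\
    (forall x : A, x^* = x ~> zero) /\
    (forall x : A, x^*^* = x).

Definition join (A : star_algebra) (x y : A) : A := (x ~> y) ~> y.

Definition meet (A : star_algebra) (x y : A) : A := (join x^* y^*)^*.

Notation "x ⊔ y" := (join x y) (at level 50, left associativity) : qw_scope.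
Notation "x ⊓ y" := (meet x y) (at level 40, left associativity) : qw_scope.

Definition QW (A : star_algebra) : Prop :=
  forall x y z : A, x ~> ((x ⊓ y) ⊓ (z ⊓ x)) = (x ~> y) ⊓ (x ~> z).

Definition An (A : star_algebra) : Prop :=
  forall x y : A, x ⊑ y -> y ⊑ x -> x = y.

Definition is_quantum_Wajsberg (A : star_algebra) : Prop :=
  is_involutive_BE A /\ QW A.

Record is_Wajsberg (A : star_algebra) : Prop := {
  wajsberg_unit : forall x : A, one ~> x = x;
  wajsberg_trans : forall x y z : A,
    (y ~> z) ~> ((z ~> x) ~> (y ~> x)) = one;
  wajsberg_comm : forall x y : A, (x ~> y) ~> y = (y ~> x) ~> x;
  wajsberg_contra : forall x y : A, (x^* ~> y^*) ~> (y ~> x) = one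
}.

(* Main.v *)
(* Everything goes through the absorption law: x ⊑ y implies y ⊔ x = y. In an
   involutive BE algebra it makes ⊑ transitive and x ⊔ y a least upper bound.
   It follows from commutativity of ⊔ at once, and from (QW) and (An) as
   follows: (QW) at z = 1 reads x ~> ((x ⊓ y) ⊓ x) = x ~> y, so if x ⊑ y then
   x ⊑ (x ⊓ y) ⊓ x; since u ⊓ v always lies below u and v, (An) gives
   x = x ⊓ y, which is the dual form of the law. Conversely, under absorption
   both sides of (QW) have the same lower bounds, by residuation. *)
Require Import Defs.
Local Open Scope qw_scope.

Definition absorptive (A : star_algebra) : Prop :=
  forall x y : A, x ⊑ y -> y ⊔ x = y.

Lemma involutive_BE_is_BE {A : star_algebra} (hA : is_involutive_BE A) :
  is_BE (@imp A) one.
Proof. destruct hA as [zero [hb _]]; exact (bounded_BE hb). Qed.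

Lemma star_star {A : star_algebra} (hA : is_involutive_BE A) (x : A) :
  x^*^* = x.
Proof. destruct hA as [zero [_ [_ h]]]; apply h. Qed.

(** Both sides unfold to [imp] into [zero], so this is the exchange law. *)
Lemma imp_star_exchange {A : star_algebra} (hA : is_involutive_BE A) (x y : A) :
  x ~> y^* = y ~> x^*.
Proof.
  destruct hA as [zero [hb [hs _]]].
  rewrite !hs; apply (be_exchange (bounded_BE hb)).
Qed.

Lemma imp_contra {A : star_algebra} (hA : is_involutive_BE A) (x y : A) :
  x^* ~> y^* = y ~> x.
Proof. now rewrite (imp_star_exchange hA), (star_star hA). Qed.

Lemma star_one_ble {A : star_algebra} (hA : is_involutive_BE A) (x : A) :
  one^* ⊑ x.
Proof.
  destruct hA as [zero [hb [hs _]]].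
  rewrite hs, (be_unit (bounded_BE hb)); apply (bounded_zero hb).
Qed.

Lemma ble_join_l {A : star_algebra} (hA : is_involutive_BE A) (x y : A) :
  x ⊑ x ⊔ y.
Proof.
  pose proof (involutive_BE_is_BE hA) as hB.
  unfold ble, join; rewrite (be_exchange hB); apply (be_refl hB).
Qed.

Lemma ble_join_r {A : star_algebra} (hA : is_involutive_BE A) (x y : A) :
  y ⊑ x ⊔ y.
Proof.
  pose proof (involutive_BE_is_BE hA) as hB.
  unfold ble, join; rewrite (be_exchange hB), (be_refl hB); apply (be_top hB).
Qed.

Lemma ble_join_of_ble {A : star_algebra} (hA : is_involutive_BE A) {x y : A} :
  x ⊑ y -> x ⊔ y = y.
Proof.
  intros h; unfold join; rewrite h; apply (be_unit (involutive_BE_is_BE hA)).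
Qed.

Lemma star_meet {A : star_algebra} (hA : is_involutive_BE A) (x y : A) :
  (x ⊓ y)^* = x^* ⊔ y^*.
Proof. apply (star_star hA). Qed.

Lemma meet_ble_l {A : star_algebra} (hA : is_involutive_BE A) (x y : A) :
  x ⊓ y ⊑ x.
Proof.
  unfold ble; rewrite <- (imp_contra hA), (star_meet hA); apply (ble_join_l hA).
Qed.

Lemma meet_ble_r {A : star_algebra} (hA : is_involutive_BE A) (x y : A) :
  x ⊓ y ⊑ y.
Proof.
  unfold ble; rewrite <- (imp_contra hA), (star_meet hA); apply (ble_join_r hA).
Qed.

(** [⊓] is not known to commute here, so each unit law gets its own proof. *)
Lemma one_meet {A : star_algebra} (hA : is_involutive_BE A) (x : A) :
  one ⊓ x = x.
Proof.
  unfold meet; rewrite (ble_join_of_ble hA); [apply (star_star hA)|].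
  apply (star_one_ble hA).
Qed.

Lemma meet_one {A : star_algebra} (hA : is_involutive_BE A) (x : A) :
  x ⊓ one = x.
Proof.
  unfold meet, join.
  rewrite (imp_contra hA), (be_unit (involutive_BE_is_BE hA)), (imp_star_exchange hA).
  now rewrite (be_unit (involutive_BE_is_BE hA)), (star_star hA).
Qed.

Lemma absorptive_of_comm {A : star_algebra} (hA : is_involutive_BE A) :
  (forall x y : A, x ⊔ y = y ⊔ x) -> absorptive A.
Proof. intros hc x y h; rewrite hc; now apply ble_join_of_ble. Qed.

Lemma absorptive_of_QW_An {A : star_algebra} (hA : is_involutive_BE A) :
  QW A -> An A -> absorptive A.
Proof.
  intros hq ha.
  assert (hm : forall x y : A, x ⊑ y -> x = x ⊓ y).
  { intros x y h.
    assert (e : x = (x ⊓ y) ⊓ x).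
    { apply ha; [|apply (meet_ble_r hA)].
      pose proof (hq x y one) as q.
      rewrite (one_meet hA), (be_top (involutive_BE_is_BE hA)), (meet_one hA) in q.
      exact (eq_trans q h). }
    (* By [e], [x] is a meet with left factor [x ⊓ y], hence lies below it. *)
    apply ha; [|apply (meet_ble_l hA)].
    pose proof (meet_ble_l hA (x ⊓ y) x) as hl; now rewrite <- e in hl. }
  intros x y h.
  (* Dualize: starring [y^* = y^* ⊓ x^*] gives [y = y ⊔ x]. *)
  assert (h' : y^* ⊑ x^*) by exact (eq_trans (imp_contra hA y x) h).
  pose proof (f_equal (@star A) (hm _ _ h')) as e.
  now rewrite (star_meet hA), !(star_star hA) in e.
Qed.

(** [y ⊔ x] equals [y] by absorption and [x] by [ble_join_of_ble]. *)
Lemma absorptive_An {A : star_algebra} (hA : is_involutive_BE A) :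
  absorptive A -> An A.
Proof.
  intros hw x y hxy hyx.
  now rewrite <- (hw x y hxy), (ble_join_of_ble hA hyx).
Qed.

(** Writing [z] as [(z ~> y) ~> y], exchange turns [x ~> z] into [(z ~> y) ~> (x ~> y)], where
    [x ~> y] is [one]. *)
Lemma ble_trans {A : star_algebra} (hA : is_involutive_BE A) (hw : absorptive A)
    {x y z : A} :
  x ⊑ y -> y ⊑ z -> x ⊑ z.
Proof.
  intros hxy hyz; rewrite <- (hw _ _ hyz); unfold ble, join.
  pose proof (involutive_BE_is_BE hA) as hB.
  rewrite (be_exchange hB), hxy; apply (be_top hB).
Qed.

Lemma imp_antitone_l {A : star_algebra} (hA : is_involutive_BE A)
    (hw : absorptive A) (x y z : A) :
  x ⊑ y -> y ~> z ⊑ x ~> z.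
Proof.
  intros h; unfold ble; rewrite (be_exchange (involutive_BE_is_BE hA)).
  exact (ble_trans hA hw h (ble_join_l hA y z)).
Qed.

Lemma imp_monotone_r {A : star_algebra} (hA : is_involutive_BE A)
    (hw : absorptive A) (x y z : A) :
  y ⊑ z -> x ~> y ⊑ x ~> z.
Proof.
  intros h; rewrite <- (imp_contra hA y x), <- (imp_contra hA z x).
  apply (imp_antitone_l hA hw); exact (eq_trans (imp_contra hA z y) h).
Qed.

(** Absorption replaces [u] by [u ⊔ y], and [(x ~> y) ~> y] is monotone in [x], being antitone twice
    over. *)
Lemma join_ble {A : star_algebra} (hA : is_involutive_BE A) (hw : absorptive A)
    (x y u : A) :
  x ⊑ u -> y ⊑ u -> x ⊔ y ⊑ u.
Proof.
  intros hx hy; rewrite <- (hw _ _ hy).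
  now apply (imp_antitone_l hA hw), (imp_antitone_l hA hw).
Qed.

Lemma ble_meet {A : star_algebra} (hA : is_involutive_BE A) (hw : absorptive A)
    (u x y : A) :
  u ⊑ x -> u ⊑ y -> u ⊑ x ⊓ y.
Proof.
  intros hx hy; unfold ble; rewrite <- (imp_contra hA), (star_meet hA).
  apply (join_ble hA hw); unfold ble; now rewrite (imp_contra hA).
Qed.

Lemma absorptive_join_comm {A : star_algebra} (hA : is_involutive_BE A) :
  absorptive A -> forall x y : A, x ⊔ y = y ⊔ x.
Proof.
  intros hw x y; apply (absorptive_An hA hw); apply (join_ble hA hw);
    first [apply (ble_join_r hA) | apply (ble_join_l hA)].
Qed.

(* [star (w ~> star x)] is the product of [w] and [x] in the residuated structure. *)
Lemma imp_residuation {A : star_algebra} (hA : is_involutive_BE A) (w x u : A) :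
  w ~> (x ~> u) = (w ~> x^*)^* ~> u.
Proof.
  rewrite <- (imp_contra hA u x), (be_exchange (involutive_BE_is_BE hA)).
  now rewrite <- (imp_contra hA u (w ~> x^*)^*), (star_star hA).
Qed.

Lemma absorptive_QW {A : star_algebra} (hA : is_involutive_BE A) :
  absorptive A -> QW A.
Proof.
  intros hw x y z; pose proof (involutive_BE_is_BE hA) as hB.
  apply (absorptive_An hA hw).
  - apply (ble_meet hA hw); apply (imp_monotone_r hA hw).
    + exact (ble_trans hA hw (meet_ble_l hA _ _) (meet_ble_r hA _ _)).
    + exact (ble_trans hA hw (meet_ble_r hA _ _) (meet_ble_l hA _ _)).
  (* With [w] the right side of (QW), it remains to put the product of [w] and [x] below [x], [y],
     [z] and [x]. Undoing residuation, the bounds [y] and [z] become [w ⊑ x ~> y] and [w ⊑ x ~> z];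
     the two bounds [x] become [w ⊑ one]. *)
  - unfold ble; rewrite (imp_residuation hA).
    apply (ble_meet hA hw); apply (ble_meet hA hw);
      unfold ble; rewrite <- (imp_residuation hA).
    2: apply (meet_ble_l hA).
    2: apply (meet_ble_r hA).
    all: rewrite (be_refl hB); apply (be_top hB).
Qed.

Lemma absorptive_is_Wajsberg {A : star_algebra} (hA : is_involutive_BE A) :
  absorptive A -> is_Wajsberg A.
Proof.
  intros hw; pose proof (involutive_BE_is_BE hA) as hB; split.
  - apply (be_unit hB).
  (* Exchange exposes [y ~> (z ⊔ x)], so [z ⊑ z ⊔ x] suffices. *)
  - intros x y z; rewrite (be_exchange hB (z ~> x) y x).
    apply (imp_monotone_r hA hw), (ble_join_l hA).
  - apply (absorptive_join_comm hA hw).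
  - intros x y; rewrite (imp_contra hA); apply (be_refl hB).
Qed.

Theorem theorem5p6 (A : star_algebra) :
  (is_involutive_BE A ->
     (QW A /\ An A <-> forall x y : A, x ⊔ y = y ⊔ x)) /\
  (is_quantum_Wajsberg A -> (is_Wajsberg A <-> An A)).
Proof.
  split.
  - intros hA; split.
    + intros [hq ha]; now apply (absorptive_join_comm hA), absorptive_of_QW_An.
    + intros hc; pose proof (absorptive_of_comm hA hc) as hw.
      split; [now apply absorptive_QW | now apply absorptive_An].
  - intros [hA hq]; split.
    + intros hW; apply (absorptive_An hA), (absorptive_of_comm hA).
      exact (wajsberg_comm hW).
    + intros ha; now apply (absorptive_is_Wajsberg hA), absorptive_of_QW_An.
Qed.
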